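(* Let $G$ be a finite simple graph and suppose there is a positive integer $k$ with $C_{\rm OR}(G)=\sqrt[k]{\omega(G^k)}$. Then $C_{\rm OR}(M(G))>C_{\rm OR}(G)$.
   Context: For graphs $F,G$ the OR-product $F\cdot G$ has vertex set $V(F)\times V(G)$, and $(f,g),(f',g')$ are adjacent iff $\{f,f'\}\in E(F)$ or $\{g,g'\}\in E(G)$. $G^t$ denotes the $t$-fold OR-product of $G$ with itself, and $\omega$ is the clique number. The (non-logarithmic) Shannon OR-capacity is $C_{\rm OR}(G)=\lim_{t\to\infty}\sqrt[t]{\omega(G^t)}$. The Mycielskian $M(G)$ of a simple graph $G$ has vertex set $V(G)\times\{0,1\}\cup\{z\}$ ($z$ a new vertex) and edge set $\{\{(v,0),(w,i)\}:\{v,w\}\in E(G),\ i\in\{0,1\}\}\cup\{\{z,(v,1)\}: v\in V(G)\}$. *)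

(* Defs.v *)
From HB Require Import structures.
From mathcomp Require Import all_boot all_order all_algebra.
From mathcomp Require Import all_classical all_reals all_analysis.
Import Order.TTheory GRing.Theory Num.Theory.
Import numFieldNormedType.Exports.
Set Implicit Arguments.
Unset Strict Implicit.
Unset Printing Implicit Defensive.
Local Open Scope ring_scope.

Record sgraph := SGraph {
  vertex :> finType;
  adj : rel vertex;
  adj_sym : symmetric adj;
  adj_irrefl : irreflexive adj }.

Definition is_clique (G : sgraph) (A : {set G}) : bool :=
  [forall x in A, forall y in A, (x != y) ==> adj x y].

Definition clique_number (G : sgraph) : nat :=
  \max_(A : {set G} | is_clique A) #|A|.

Section OrProduct.
Variables F G : sgraph.

Definition or_adj : rel (F * G)%type :=
  fun x y => adj x.1 y.1 || adj x.2 y.2.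

Lemma or_adj_sym : symmetric or_adj.
Proof. by move=> x y; rewrite /or_adj adj_sym [adj x.2 _]adj_sym. Qed.

Lemma or_adj_irrefl : irreflexive or_adj.
Proof. by move=> x; rewrite /or_adj !adj_irrefl. Qed.

Definition or_product : sgraph := SGraph or_adj_sym or_adj_irrefl.

End OrProduct.

Lemma no_adj_sym (T : Type) : symmetric (fun _ _ : T => false).
Proof. by []. Qed.

Lemma no_adj_irrefl (T : Type) : irreflexive (fun _ _ : T => false).
Proof. by []. Qed.

Definition one_vertex_graph : sgraph :=
  SGraph (@no_adj_sym unit) (@no_adj_irrefl unit).

(* [or_power G 1] is [G] itself and [or_power G t.+2] is the OR-product of [G]
   with [or_power G t.+1]; the empty product is the one-vertex graph. *)
Definition or_power (G : sgraph) (t : nat) : sgraph :=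
  iterop t or_product G one_vertex_graph.

(* The sequence converges for every [G]: [clique_number (or_power G t)] is
   supermultiplicative in [t] and at most [#|G| ^ t] for [t > 0]. Hence [limn]
   is a genuine limit here. The term at [t = 0] is a junk value. *)
Definition or_capacity (R : realType) (G : sgraph) : R :=
  limn (fun t : nat => (clique_number (or_power G t))%:R `^ (t%:R^-1) : R).

Section Mycielskian.
Variable G : sgraph.

(* [Some (v, false)] and [Some (v, true)] stand for (v,0) and (v,1);
   [None] stands for z. *)
Definition mycielski_adj : rel (option (G * bool)) := fun x y =>
  match x, y with
  | Some (v, i), Some (w, j) => adj v w && (~~ i || ~~ j)
  | None, Some (_, i) | Some (_, i), None => i
  | None, None => false
  end.

Lemma mycielski_adj_sym : symmetric mycielski_adj.
Proof. by move=> [[v i]|] [[w j]|] //=; rewrite adj_sym orbC. Qed.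

Lemma mycielski_adj_irrefl : irreflexive mycielski_adj.
Proof. by move=> [[v i]|] //=; rewrite adj_irrefl. Qed.

Definition mycielskian : sgraph :=
  SGraph mycielski_adj_sym mycielski_adj_irrefl.

End Mycielskian.

(* Main.v *)
Require Import Defs.
From HB Require Import structures.
From mathcomp Require Import all_boot all_order all_algebra.
From mathcomp Require Import all_classical all_reals all_analysis.
From mathcomp Require Import ring lra.
Import Order.TTheory GRing.Theory Num.Theory.
Import numFieldNormedType.Exports.
Set Implicit Arguments.
Unset Strict Implicit.
Local Open Scope ring_scope.

(** By Fekete's lemma the capacity of a graph [H] is at least the [t]-th root of
    the clique number of [H^t], for every [t > 0]. So it suffices to find a power
    [t] for which [M(G)^t] has a clique with more than [N ^ (t/k)] elements, where
    [N] is the clique number of [G^k]. Let [K] be a clique of size [N] in [G^k],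
    labelled by Z/N, and take [t = N * k]. Lift each word of [K^N] to [M(G)^t] by
    using level 1 in the block whose index is the sum of the labels mod [N], and
    level 0 in all the other blocks. Distinct words with the same sum differ in at
    least two blocks, hence in a block which is at level 0 in both, so all lifted
    words remain pairwise adjacent. Since every lifted word has coordinates at
    level 1, the word [z...z] is adjacent to all of them, which gives a clique of
    size [N ^ N + 1]. *)

(** * Cliques in OR-powers *)

(* Words are infinite; only the first [t] letters matter. *)
Definition word_adj (G : sgraph) (t : nat) (f g : nat -> G) : Prop :=
  exists2 p, (p < t)%N & adj (f p) (g p).

(** An indexed family can stand for a clique: since [adj] is irreflexive, the adjacency of distinct
    members makes the family injective. *)
Definition word_clique (G : sgraph) (t : nat) (I : finType)
    (f : I -> nat -> G) : Prop :=
  forall i j, i != j -> word_adj t (f i) (f j).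

Lemma word_adjS (G : sgraph) t (f g : nat -> G) :
  word_adj t.+1 f g <->
  adj (f 0%N) (g 0%N) \/ word_adj t (f \o succn) (g \o succn).
Proof.
split; last by case=> [|[p]]; [exists 0%N | exists p.+1].
by case=> -[|p] ltp a; [left | right; exists p].
Qed.

Lemma or_power_of_word (G : sgraph) t : exists e : (nat -> G) -> or_power G t,
  forall f g, word_adj t f g -> adj (e f) (e g).
Proof.
elim: t => [|[|t] [e eP]]; first by exists (fun=> tt) => f g [].
  by exists (fun f => f 0%N) => f g [[|//]].
exists (fun f => (f 0%N, e (f \o succn))) => f g /word_adjS /= [a|/eP a].
  by apply/orP; left.
by apply/orP; right.
Qed.

(** For [t = 0] the only vertex must still become a word, which takes a letter from [G]. *)
Lemma word_of_or_power (G : sgraph) t : (0 < t)%N \/ inhabited G ->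
  exists d : or_power G t -> nat -> G,
  forall x y, adj x y -> word_adj t (d x) (d y).
Proof.
case: t => [[//|[x0]]|t _]; first by exists (fun _ _ => x0).
elim: t => [|t [d dP]]; first by exists (fun x _ => x) => x y a; exists 0%N.
exists (fun x p => if p is q.+1 then d x.2 q else x.1) => x y.
by case/orP => [a|/dP a]; apply/word_adjS; [left | right].
Qed.

Lemma card_or_power (G : sgraph) t : #|or_power G t| = (#|G| ^ t)%N.
Proof.
elim: t => [|[|t] IH]; [exact: card_unit | by rewrite expn1 |].
by rewrite [LHS](card_prod G (or_power G t.+1)) IH -expnS.
Qed.

Lemma clique_number_le (G : sgraph) : (clique_number G <= #|G|)%N.
Proof. by apply/bigmax_leqP => A _; apply: max_card. Qed.

Lemma word_clique_le (G : sgraph) t (I : finType) (f : I -> nat -> G) :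
  word_clique t f -> (#|I| <= clique_number (or_power G t))%N.
Proof.
move=> fP; have [e eP] := or_power_of_word G t.
have ef_inj : injective (e \o f).
  move=> i j eij; apply/eqP; apply: contraTT isT => /fP/eP.
  by move: eij => /= ->; rewrite adj_irrefl.
rewrite -(card_codom ef_inj) -cardsE.
apply: (leq_bigmax_cond (F := fun A : {set _} => #|A|)).
apply/forall_inP => x; rewrite inE => /codomP[i ->].
apply/forall_inP => y; rewrite inE => /codomP[j ->].
by apply/implyP => nij; apply/eP/fP; apply: contra nij => /eqP ->.
Qed.

Lemma word_clique_max (G : sgraph) t : (0 < t)%N \/ inhabited G ->
  exists f : 'I_(clique_number (or_power G t)) -> nat -> G, word_clique t f.
Proof.
move=> ht; have [d dP] := word_of_or_power ht.
rewrite /clique_number.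
have [|A cA ->] := @eq_bigmax_cond _ (@is_clique (or_power G t)) (fun A => #|A|).
  apply/card_gt0P; exists finset.set0; apply/forall_inP => x.
  by rewrite inE.
exists (fun i => d (enum_val i)) => i j nij; apply: dP.
move/forall_inP: cA => /(_ _ (enum_valP i)) /forall_inP /(_ _ (enum_valP j)).
by move/implyP; apply; rewrite (inj_eq enum_val_inj).
Qed.

(** Concatenating the words of two cliques gives a clique indexed by pairs. *)
Lemma clique_number_or_powerD (G : sgraph) m n : inhabited G ->
  (clique_number (or_power G m) * clique_number (or_power G n) <=
   clique_number (or_power G (m + n)))%N.
Proof.
move=> G0; have [f fP] := @word_clique_max G m (or_intror G0).
have [g gP] := @word_clique_max G n (or_intror G0).
rewrite -[X in (X * _)%N]card_ord -[X in (_ * X)%N]card_ord -card_prod.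
apply: (@word_clique_le _ _ _
  (fun ij p => if (p < m)%N then f ij.1 p else g ij.2 (p - m)%N)).
move=> [i j] [i' j'] nij /=; have [eii|ni] := eqVneq i i'.
  have /gP[p ltp a] : j != j' by apply: contra nij => /eqP ->; rewrite eii.
  by exists (m + p)%N; rewrite ?ltn_add2l // ltnNge leq_addr addKn.
have [p ltp a] := fP _ _ ni.
by exists p; rewrite ?ltp // ltn_addr.
Qed.

Lemma clique_number_or_power_gt0 (G : sgraph) t : inhabited G ->
  (0 < clique_number (or_power G t))%N.
Proof.
move=> [x]; rewrite -card_unit.
by apply: (@word_clique_le _ _ _ (fun _ _ => x)) => -[] [].
Qed.

(** * Convergence to the capacity *)

Section Fekete.
Variables (R : realType) (b : nat -> R) (c : R).
Hypothesis b_ge0 : forall n, 0 <= b n.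
Hypothesis bD : forall m n, b m + b n <= b (m + n)%N.
Hypothesis b_le : forall n, b n <= n%:R * c.

Lemma superadditive_mul_le m q : q%:R * b m <= b (q * m)%N.
Proof.
elim: q => [|q IH]; first by rewrite mul0r.
rewrite mulSn; apply: le_trans (bD _ _).
by rewrite -natr1 mulrDl mul1r addrC lerD2l.
Qed.

(** Divide with remainder, [n = q * m + r]: then [b n] is at least [q * b m], while
    [(q + 1) * m > n]. For fixed [m] the error [b m / n] tends to 0. *)
Lemma superadditive_slope_le m n : (0 < m)%N -> (0 < n)%N ->
  b m / m%:R - b m / n%:R <= b n / n%:R.
Proof.
move=> m0 n0.
have m0R : 0 < m%:R :> R by rewrite ltr0n.
have n0R : 0 < n%:R :> R by rewrite ltr0n.
rewrite ler_pdivlMr // mulrBl divfK ?gt_eqF //.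
have le1 : (n %/ m)%:R * b m <= b n.
  rewrite [X in _ <= b X](divn_eq n m); apply: le_trans (bD _ _).
  by rewrite ler_wpDr // superadditive_mul_le.
apply: le_trans le1; rewrite lerBlDr mulrAC ler_pdivrMr //.
have -> : ((n %/ m)%:R * b m + b m) * m%:R = b m * ((n %/ m).+1 * m)%:R.
  by rewrite natrM -natr1; ring.
by rewrite ler_wpM2l // ler_nat ltnW // ltn_ceil.
Qed.

Lemma superadditive_cvg : exists2 l : R,
  ((fun n => b n / n%:R) @ \oo --> l)%classic &
  forall m, (0 < m)%N -> b m / m%:R <= l.
Proof.
(* The limit is the supremum of the slopes at positive indices. *)
pose S := [set b m.+1 / m.+1%:R | m in [set: nat]]%classic.
have S_ub : has_ubound S.
  by exists c => _ [m _ <-]; rewrite ler_pdivrMr ?ltr0n // mulrC.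
have S_sup : has_sup S by split=> //; exists (b 1 / 1), 0%N.
have le_sup m : (0 < m)%N -> b m / m%:R <= sup S.
  by case: m => // m _; apply: ub_le_sup => //; exists m.
exists (sup S) => //; apply/cvgrPdist_le => e e0.
have e2 : 0 < e / 2 by rewrite divr_gt0.
have [_ [m _ <-] lt_m] := sup_adherent e2 S_sup.
near=> n.
have n0 : (0 < n)%N by near: n; exact: nbhs_infty_gt.
rewrite ger0_norm ?subr_ge0 ?le_sup //.
have := superadditive_slope_le (ltn0Sn m) n0.
suff : b m.+1 / n%:R <= e / 2.
  move: lt_m; move: (b m.+1 / m.+1%:R) (b m.+1 / n%:R) (b n / n%:R) => x y z.
  by lra.
rewrite ler_pdivrMr ?ltr0n // mulrC -ler_pdivrMr //.
by near: n; exact: nbhs_infty_ger.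
Unshelve. all: by end_near.
Qed.

End Fekete.

Lemma clique_number_root_le_or_capacity (R : realType) (G : sgraph) t :
  inhabited G -> (0 < t)%N ->
  (clique_number (or_power G t))%:R `^ (t%:R^-1) <= or_capacity R G.
Proof.
move=> G0 t0; pose w n := clique_number (or_power G n).
have w0 n : 0 < (w n)%:R :> R by rewrite ltr0n clique_number_or_power_gt0.
have w1 n : 1 <= (w n)%:R :> R by rewrite ler1n clique_number_or_power_gt0.
have g0 : 0 < #|G|%:R :> R.
  by case: G0 => x; rewrite ltr0n; apply/card_gt0P; exists x.
pose b n : R := ln (w n)%:R.
have b_ge0 n : 0 <= b n by rewrite ln_ge0.
have bD m n : b m + b n <= b (m + n)%N.
  by rewrite -lnM ?posrE // ler_ln ?posrE ?mulr_gt0 // -natrM ler_nat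
    clique_number_or_powerD.
have b_le n : b n <= n%:R * ln #|G|%:R.
  rewrite mulr_natl -lnXn // ler_ln ?posrE ?exprn_gt0 // -natrX ler_nat.
  by rewrite -card_or_power clique_number_le.
(* Also true at [n = 0], so the two sequences agree everywhere. *)
have wE n : (w n)%:R `^ (n%:R^-1) = expR (b n / n%:R).
  by rewrite /powR gt_eqF // mulrC.
have [l bl le_l] := superadditive_cvg b_ge0 bD b_le.
rewrite /or_capacity -/(w t) wE.
suff -> : limn (fun n => (w n)%:R `^ (n%:R^-1) : R) = expR l.
  by rewrite ler_expR le_l.
apply: cvg_lim => //.
rewrite (_ : (fun n => _) = expR \o (fun n => b n / n%:R)); last exact/funext.
by apply: continuous_cvg bl; exact: continuous_expR.
Qed.

(** * The Mycielskian *)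

(** The entry at [c] is determined by the sum and the other entries. Here [c] will be the block at
    level 1. *)
Lemma ffun_same_sum (T : finType) (V : zmodType) (x y : {ffun T -> V}) (c : T) :
  x != y -> \sum_i x i = \sum_i y i -> exists2 i, i != c & x i != y i.
Proof.
move=> nxy sxy; have [/exists_inP //|] := boolP [exists (i | i != c), x i != y i].
move/exists_inPn => eq_xy; case/eqP: nxy; apply/ffunP => i.
have eq_ne j : j != c -> x j = y j by move=> /eq_xy/negPn/eqP.
have [->|/eq_ne //] := eqVneq i c.
move: sxy; rewrite (bigD1 c) //= [RHS](bigD1 c) //=.
by rewrite (eq_bigr y) => [/addIr|j /eq_ne].
Qed.

Lemma mycielskian_word_clique (G : sgraph) k n (f : 'I_n.+1 -> nat -> G) :
  (0 < k)%N -> word_clique k f ->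
  (n.+1 ^ n.+1 < clique_number (or_power (mycielskian G) (n.+1 * k)))%N.
Proof.
move=> k0 fP.
pose cl (x : {ffun 'I_n.+1 -> 'I_n.+1}) : 'I_n.+1 := \sum_i x i.
(* Position [p] is letter [p %% k] of block [p %/ k]; [None] indexes the word made of z only. *)
pose w (o : option {ffun 'I_n.+1 -> 'I_n.+1}) (p : nat) : mycielskian G :=
  if o is Some x then
    Some (f (x (inord (p %/ k))) (p %% k)%N, inord (p %/ k) == cl x)
  else None.
have lt_pos (i : 'I_n.+1) p : (p < k)%N -> (i * k + p < n.+1 * k)%N.
  move=> ltp; apply: (@leq_trans (i.+1 * k)); last by rewrite leq_mul2r ltn_ord orbT.
  by rewrite mulSn addnC ltn_add2r.
have wE x (i : 'I_n.+1) p : (p < k)%N ->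
    w (Some x) (i * k + p)%N = Some (f (x i) p, i == cl x).
  by move=> ltp; rewrite /w divnMDl // divn_small // addn0 inord_val
    modnMDl modn_small.
suff /word_clique_le : word_clique (n.+1 * k) w.
  by rewrite card_option card_ffun !card_ord.
move=> [x|] [y|] //= nxy; last 2 first.
- exists (cl x * k + 0)%N; first exact: lt_pos.
  by rewrite wE //= eqxx.
- exists (cl y * k + 0)%N; first exact: lt_pos.
  by rewrite wE //= eqxx.
have {}nxy : x != y by apply: contra nxy => /eqP ->.
(* An edge needs level 0 at one end only. If the sums differ, no block is at level 1 in both words,
   so any block where they differ will do. *)
have [i ni hi] : exists2 i, x i != y i & (i != cl x) || (i != cl y).
  have [e|ne] := eqVneq (cl x) (cl y).
    by have [i nc ni] := ffun_same_sum (cl x) nxy e; exists i; rewrite ?nc.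
  have [i ni] : exists i, x i != y i.
    apply/existsP; apply: contraR nxy => /existsPn h.
    by apply/eqP/ffunP => i; apply/eqP/negPn/h.
  exists i => //; rewrite -negb_and; apply: contra ne.
  by case/andP => /eqP <- /eqP <-.
have [p ltp a] := fP _ _ ni.
by exists (i * k + p)%N; rewrite ?lt_pos // !wE //= a hi.
Qed.

Theorem theorem1 (R : realType) (G : sgraph)
  (hG : exists k : nat, (0 < k)%N /\
    or_capacity R G = (clique_number (or_power G k))%:R `^ (k%:R^-1)) :
  or_capacity R G < or_capacity R (mycielskian G).
Proof.
case: hG => k [k0 ->].
have M0 : inhabited (mycielskian G) by exact: (inhabits None).
have [f fP] := @word_clique_max G k (or_introl k0).
have k0R : 0 < k%:R :> R by rewrite ltr0n.
case: (clique_number (or_power G k)) f fP => [_ _|n f fP].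
  (* Clique number 0: the root is 0, but [mycielskian G] has the vertex z, so its capacity is
     positive. *)
  rewrite powR0 ?invr_eq0 ?gt_eqF //.
  apply: lt_le_trans (clique_number_root_le_or_capacity R M0 (ltn0Sn 0)).
  by rewrite powR_gt0 // ltr0n clique_number_or_power_gt0.
have t0 : (0 < n.+1 * k)%N by rewrite muln_gt0.
apply: lt_le_trans (clique_number_root_le_or_capacity R M0 t0).
(* Bring both sides to roots of the same order [n.+1 * k]. *)
have -> : n.+1%:R `^ (k%:R^-1) = (n.+1 ^ n.+1)%:R `^ ((n.+1 * k)%:R^-1) :> R.
  by rewrite natrX -powR_mulrn // -powRrM natrM invfM mulrA divff ?mul1r.
apply: gt0_ltr_powR; rewrite ?nnegrE ?invr_gt0 ?ltr0n //.
by rewrite ltr_nat (mycielskian_word_clique k0 fP).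
Qed.
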